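(* Let $0\le p<n$ and let $\gamma=[1^p,n-p]\vdash n$ be the partition with $p$ parts equal to $1$ and one further part equal to $n-p$. Let $m>0$. If $n-p-m$ is even, then $$\mu_{n,m}(\gamma)=\frac{2{n+1-p\brack m}}{(n+1-p)!}\,|\mathcal{C}_\gamma|,$$ and if $n-p-m$ is odd, then $\mu_{n,m}(\gamma)=0$.
   Context: Fix $\omega=(1\,2\,\cdots\,n)$. For $\gamma\vdash n$ and $m\ge1$, $\mu_{n,m}(\gamma)$ is the number of pairs $(\sigma,\pi)$ of permutations of $[n]$ with $\sigma\pi=\omega$, $\sigma$ of cycle type $\gamma$, and $\pi$ having exactly $m$ cycles. $|\mathcal{C}_\gamma|$ is the number of permutations of $[n]$ of cycle type $\gamma$. ${n\brack k}$ is the unsigned Stirling number of the first kind (zero if $k>n$). *)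

(* Defs.v *)
From mathcomp Require Import all_boot all_order all_algebra all_fingroup.
Set Implicit Arguments. Unset Strict Implicit. Unset Printing Implicit Defensive.

(* The long cycle omega = (1 2 ... n), realised on 'I_n as i |-> i+1 mod n. *)
Definition omega (n : nat) : 'S_n := perm (@ordS_inj n).

Definition ncycles (n : nat) (s : 'S_n) : nat := #|porbits s|.

Definition has_cycle_type (n : nat) (s : 'S_n) (g : seq nat) : bool :=
  perm_eq [seq #|(X : {set 'I_n})| | X <- enum (porbits s)] g.

Definition mu (n m : nat) (g : seq nat) : nat :=
  #|[set sp : 'S_n * 'S_n |
      [&& [forall x, sp.1 (sp.2 x) == omega n x],
          has_cycle_type sp.1 g & ncycles sp.2 == m]]|.

Definition class_size (n : nat) (g : seq nat) : nat :=
  #|[set s : 'S_n | has_cycle_type s g]|.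

Fixpoint stirling1 (n k : nat) : nat :=
  match n, k with
  | 0, 0 => 1
  | 0, _.+1 => 0
  | _.+1, 0 => 0
  | n'.+1, k'.+1 => n' * stirling1 n' k'.+1 + stirling1 n' k'
  end.

Definition hook_partition (n p : nat) : seq nat := rcons (nseq p 1) (n - p).

(* Main.v *)
(* Deleting the points outside a (n-p)-set S from omega turns a factorization
   omega = sigma pi, with sigma a full cycle on S, into one of a full cycle on S,
   without changing the number of cycles of pi.  So everything reduces to counting
   the pairs of k-cycles on a k-set (k = n-p) with a quotient having m cycles.

   Add a spare point.  For t on a (k+1)-set D, the number of ways to write t as a
   product of a (k+1)-cycle and a k-cycle is obtained by choosing the fixed point i
   of the k-cycle and deleting i from t; it equals the sum over i (not fixed by t)
   of the number h(t \ i) of factorizations of t \ i into two k-cycles.  By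
   Boccara's theorem it is 2(k-1)! for every odd t.  This is proved by induction on
   the number of points: deleting n from (n j) t expresses both h(t) and the sum
   of the h(t \ i) through smaller instances, the former in two ways (deleting n
   or deleting j), and the deletions of distinct points commute.
   Summing over the t with m cycles brings in the Stirling number [k+1, m]. *)
Require Import Defs.
From mathcomp Require Import all_boot all_order all_algebra all_fingroup.
From mathcomp Require Import zify.
Set Implicit Arguments. Unset Strict Implicit. Unset Printing Implicit Defensive.
Local Open Scope group_scope.

Ltac eq_cases := repeat (match goal with |- context [@eq_op ?S ?a ?b] =>
  lazymatch constr:((a, b)) with
  | context [if _ then _ else _] => fail
  | _ => case: (@eqP S a b) => ?
  end end; simpl).

Lemma stirling1_1 k : stirling1 k.+1 1 = k`!.
Proof.
by elim: k => // k IH; rewrite factS -IH [LHS]/= addn0.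
Qed.

(** * Cycles on a subset and deletion of a point from a permutation *)

Section CycleSurgery.
Variable T : finType.
Implicit Types (s t u a b : {perm T}) (D E : {set T}) (i j n x y : T).

(* A permutation of [D] is a single cycle on [D] iff its fixed points outside [D]
   and one further orbit are all its orbits. *)
Definition full_cycle D b := perm_on D b && (#|porbits b| + #|D| == #|T|.+1)%N.

Lemma perm_onS D E s : D \subset E -> perm_on D s -> perm_on E s.
Proof. by move=> sDE /subset_trans; apply. Qed.

Lemma perm_onD1 D s i : perm_on D s -> s i = i -> perm_on (D :\ i) s.
Proof.
move=> /subsetP sD si; apply/subsetP => x; rewrite !inE => sx.
by rewrite (sD x) ?inE // andbT; apply: contra_neq sx => ->.
Qed.

Lemma perm_on_tperm D i j : i \in D -> j \in D -> perm_on D (tperm i j).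
Proof.
by move=> iD jD; apply: perm_onS (tperm_on i j); rewrite subUset !sub1set iD.
Qed.

(** The fixed point [i] is merged into the orbit of [j]. Inversion reduces this to left
    multiplication by a transposition. *)
Lemma card_porbits_mulr_tperm s i j : s i = i -> i != j ->
  #|porbits (s * tperm i j)|.+1 = #|porbits s|.
Proof.
move=> si ij.
have /= := porbits_mul_tperm s^-1 i j.
have -> : tperm i j * s^-1 = (s * tperm i j)^-1 by rewrite invMg tpermV.
rewrite !porbitsV ij porbitV.
have /negPf -> : i \notin porbit s j; last by rewrite /=; lia.
apply: contra ij; rewrite porbit_sym => /porbitP[k ->].
by rewrite permX; elim: k => //= k /eqP <-; rewrite si.
Qed.

Lemma card_porbits1 : #|porbits (1 : {perm T})| = #|T|.
Proof.
rewrite card_imset // => x y /eqP; rewrite eq_porbit_mem => /porbitP[j ->].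
by rewrite expg1n perm1.
Qed.

(** At least one orbit lies inside [D]. Deleting a moved point creates one orbit and shrinks [D] by
    one; a fixed point is simply dropped from [D]. *)
Lemma card_porbits_gt D s : perm_on D s -> D != set0 ->
  (#|T| < #|porbits s| + #|D|)%N.
Proof.
have [k] := ubnP #|D|; elim: k D s => // k IH D s ltDk sD /set0Pn[i iD].
have cD := cardsD1 i D; rewrite iD in cD.
have [D0 | D0] := eqVneq (D :\ i) set0.
  rewrite D0 cards0 in cD.
  have -> : s = 1.
    apply/permP=> x; rewrite perm1; apply/eqP.
    have [xi | xi] := eqVneq x i; last first.
      by rewrite (out_perm sD) //; apply: contraTN isT => xD; move/setP/(_ x): D0; rewrite !inE xi xD.
    have := perm_closed i sD; rewrite iD xi => siD.
    by apply: contraTT siD => si; apply: contraTN isT => xD; move/setP/(_ (s i)): D0; rewrite !inE si xD.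
  by rewrite card_porbits1; lia.
have [si | si] := eqVneq (s i) i.
  have := IH _ _ _ (perm_onD1 sD si) D0; lia.
pose r := s * tperm i (s i).
have ri : r i = i by rewrite permM tpermR.
have rD : perm_on (D :\ i) r.
  by apply: perm_onD1 => //; apply: perm_onM => //; apply: perm_on_tperm; rewrite ?(perm_closed _ sD).
have sE : s = r * tperm i (s i) by rewrite -mulgA tperm2 mulg1.
have := card_porbits_mulr_tperm (j := s i) ri; rewrite eq_sym => /(_ si); rewrite -sE.
have := IH _ _ _ rD D0; lia.
Qed.

(** Products apply the left factor first, so this bypasses [i] in its cycle and leaves it fixed. *)
Definition remove i t := t * tperm i (t i).

Lemma removeE i t x :
  remove i t x = if x == i then i else if t x == i then t i else t x.
Proof.
rewrite permM; have [-> | xi] := eqVneq x i; first by rewrite tpermR.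
have [-> | tx] := eqVneq (t x) i; first by rewrite tpermL.
by rewrite tpermD // 1?eq_sym // (inj_eq perm_inj).
Qed.

Lemma remove_fix i t : remove i t i = i.
Proof. by rewrite removeE eqxx. Qed.

Lemma removeK i t : remove i t * tperm i (t i) = t.
Proof. by rewrite -mulgA tperm2 mulg1. Qed.

Lemma perm_on_remove D i t : i \in D -> perm_on D t -> perm_on (D :\ i) (remove i t).
Proof.
move=> iD tD; apply: perm_onD1 (remove_fix i t).
by apply: perm_onM => //; apply: perm_on_tperm; rewrite ?(perm_closed _ tD).
Qed.

Lemma card_porbits_remove i t :
  #|porbits (remove i t)| = (#|porbits t| + (t i != i))%N.
Proof.
have [ti | ti] := eqVneq (t i) i; first by rewrite /remove ti tperm1 mulg1 addn0.
have := card_porbits_mulr_tperm (j := t i) (remove_fix i t); rewrite eq_sym => /(_ ti).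
by rewrite removeK addn1.
Qed.

Lemma odd_remove i t : odd_perm (remove i t) = odd_perm t (+) (t i != i).
Proof. by rewrite odd_permM odd_tperm eq_sym. Qed.

Lemma removeC i j t : remove i (remove j t) = remove j (remove i t).
Proof.
apply/permP => x; rewrite !removeE.
have inj y z : y <> z -> t y <> t z by move=> yz /perm_inj.
move: (inj x i) (inj x j) (inj i j); eq_cases; intuition congruence.
Qed.

(** Both sides say that [t] fixes neither point and does not swap them. This matches the side
    conditions when two deletions are exchanged. *)
Lemma remove_nonfixC i j t : i != j ->
  (t i != i) && (remove i t j != j) = (t j != j) && (remove j t i != i).
Proof.
move=> ij; rewrite !removeE [j == i]eq_sym (negPf ij).
have inj : t i != t j by rewrite (inj_eq perm_inj).
by move/eqP: inj; move/eqP: ij; eq_cases; congruence.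
Qed.

Lemma full_cycle_perm_on D b : full_cycle D b -> perm_on D b.
Proof. by case/andP. Qed.

Lemma full_cycle_nonfix D b i : full_cycle D b -> i \in D -> D :\ i != set0 -> b i != i.
Proof.
case/andP=> bD /eqP cb iD D0; apply/eqP => bi.
have := card_porbits_gt (perm_onD1 bD bi) D0; have := cardsD1 i D; rewrite iD; lia.
Qed.

(** Multiplying by [tperm i j] inserts [i] just before [j] in its cycle: one orbit fewer, one point
    more. *)
Lemma full_cycle_mul_tperm D s i j :
  i \in D -> j \in D :\ i -> perm_on (D :\ i) s ->
  full_cycle D (s * tperm i j) = full_cycle (D :\ i) s.
Proof.
move=> iD; rewrite !inE => /andP[ji jD] sD.
have si : s i = i by rewrite (out_perm sD) // !inE eqxx.
rewrite /full_cycle sD perm_onM ?perm_on_tperm //=; last first.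
  by apply: perm_onS sD; apply: subD1set.
have := card_porbits_mulr_tperm (j := j) si; rewrite eq_sym => /(_ ji).
have := cardsD1 i D; rewrite iD. move=> /= h1 h2; apply/eqP/eqP; lia.
Qed.

Lemma full_cycle_remove D i b : i \in D -> D :\ i != set0 -> full_cycle D b ->
  full_cycle (D :\ i) (remove i b).
Proof.
move=> iD D0 bD; have bi := full_cycle_nonfix bD iD D0.
have bon := full_cycle_perm_on bD.
rewrite -(full_cycle_mul_tperm (j := b i) iD) ?removeK ?perm_on_remove //.
by rewrite !inE bi (perm_closed _ bon).
Qed.

(** * Recursions for factorizations into two full cycles *)

Lemma sum_full_cycle D (P : pred {perm T}) i j : i \in D -> j \in D :\ i ->
  \sum_(b | full_cycle D b && P b && (b i == j)) 1 =
  \sum_(b | full_cycle (D :\ i) b && P (b * tperm i j)) 1.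
Proof.
move=> iD jD; rewrite (reindex_inj (mulIg (tperm i j))) /=.
apply: eq_bigl => b; have ji : j != i by move: jD; rewrite !inE => /andP[].
have -> : ((b * tperm i j) i == j) = (b i == i).
  by rewrite permM -{2}(tpermL i j) (inj_eq perm_inj).
have [bi | bi] := eqVneq (b i) i; rewrite ?andbT ?andbF.
  case bD: (perm_on (D :\ i) b); first by rewrite full_cycle_mul_tperm.
  have -> : full_cycle (D :\ i) b = false by rewrite /full_cycle bD.
  apply/negbTE; apply: contraFN bD => /andP[/full_cycle_perm_on bD _].
  apply: perm_onD1 => //; rewrite -[b]mulg1 -(tperm2 i j) mulgA.
  by apply: perm_onM => //; apply: perm_on_tperm => //; move: jD; rewrite !inE => /andP[].
apply/esym/negbTE; apply: contra bi => /andP[/full_cycle_perm_on bD _].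
by rewrite (out_perm bD) // !inE eqxx.
Qed.

(* Counts the factorizations of [t] into two full cycles on [D]. *)
Definition nfact D t := \sum_(b | full_cycle D b && full_cycle D (b * t)) 1.

(** As [b] fixes [i], [b * t] sends [i] to [t i]. If this is not [i], then [b * t] is
    [b * remove i t] with [i] inserted before [t i]. *)
Lemma sum_full_cycle_nfact D t i : i \in D -> D :\ i != set0 -> perm_on D t ->
  \sum_(b | full_cycle (D :\ i) b && full_cycle D (b * t)) 1 =
  if t i != i then nfact (D :\ i) (remove i t) else 0%N.
Proof.
move=> iD D0 tD; case: ifPn => [ti | /negbNE/eqP ti].
  apply: eq_bigl => b; case bD: (full_cycle (D :\ i) b) => //=.
  rewrite -{1}[t](removeK i) mulgA full_cycle_mul_tperm //.
    by rewrite !inE ti (perm_closed _ tD).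
  by apply: perm_onM (full_cycle_perm_on bD) _; apply: perm_on_remove.
rewrite big_pred0 // => b; apply/negbTE/negP => /andP[/full_cycle_perm_on bD].
move/full_cycle_nonfix => /(_ _ iD D0); rewrite permM (out_perm bD) ?ti ?eqxx //.
by rewrite !inE eqxx.
Qed.

Lemma full_cycle_im D b i : full_cycle D b -> i \in D -> D :\ i != set0 -> b i \in D :\ i.
Proof.
move=> bD iD D0; rewrite !inE (full_cycle_nonfix bD) //.
by rewrite (perm_closed _ (full_cycle_perm_on bD)).
Qed.

(** The factor [b] is sorted by [j = b n]. Deleting [n] from [b] passes [tperm n j] on to [t], and
    [t j != n] says that the new permutation moves [n]. *)
Lemma nfact_recr D t n : n \in D -> D :\ n != set0 -> perm_on D t ->
  nfact D t = \sum_(j in D :\ n | t j != n) nfact (D :\ n) (remove n (tperm n j * t)).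
Proof.
move=> nD D0 tD; rewrite /nfact.
rewrite (partition_big (fun b => b n) (mem (D :\ n))) /=; last first.
  by move=> b /andP[bD _]; apply: full_cycle_im.
rewrite [RHS]big_mkcondr /=; apply: eq_bigr => j jD.
rewrite (sum_full_cycle (fun b => full_cycle D (b * t)) nD jD) /=.
under eq_bigl => b do rewrite -mulgA.
rewrite sum_full_cycle_nfact //; last first.
  by apply: perm_onM => //; apply: perm_on_tperm => //; move: jD; rewrite !inE => /andP[].
by rewrite permM tpermL.
Qed.

(** Here [b] is sorted by [j = b^-1 n], and [j] rather than [n] is deleted from it. *)
Lemma nfact_recl D t n : n \in D -> D :\ n != set0 -> perm_on D t ->
  nfact D t = \sum_(j in D :\ n | t n != j) nfact (D :\ j) (remove j (tperm j n * t)).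
Proof.
move=> nD D0 tD; rewrite /nfact.
rewrite (partition_big (fun b => b^-1 n) (mem (D :\ n))) /=; last first.
  move=> b /andP[bD _]; have bon := full_cycle_perm_on bD; rewrite !inE.
  have -> : (b^-1 n != n) = (b n != n).
    by rewrite -{2}[n](permK b) (inj_eq perm_inj) eq_sym.
  by rewrite (full_cycle_nonfix bD) // (perm_closed _ (perm_onV bon)).
rewrite [RHS]big_mkcondr /=; apply: eq_bigr => j; rewrite !inE => /andP[jn jD].
have nDj : n \in D :\ j by rewrite !inE eq_sym jn.
have Dj0 : D :\ j != set0 by apply/set0Pn; exists n.
under eq_bigl => b.
  have -> : (b^-1 n == j) = (b j == n) by rewrite -(inj_eq (@perm_inj _ b)) permKV eq_sym.
  over.
rewrite (sum_full_cycle (fun b => full_cycle D (b * t)) jD nDj) /=.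
under eq_bigl => b do rewrite -mulgA.
rewrite sum_full_cycle_nfact //; last by apply: perm_onM => //; apply: perm_on_tperm.
by rewrite permM tpermL.
Qed.

(* By [sum_full_cycle_nfact], this counts the factorizations of [t] into a full cycle
   on [D] and a full cycle on [D] minus a point. *)
Definition nfact_near D t :=
  \sum_(i in D | t i != i) nfact (D :\ i) (remove i t).

(** Once [n] is gone, its preimage [m] takes over its role in the transposition. *)
Lemma remove_tperm n j m t : m != n -> t m = n -> j != n -> t j != n ->
  remove n (tperm n j * t) = tperm j m * remove n t.
Proof.
move=> mn tm jn tj; have jm : j != m by apply: contra_neq tj => ->.
have tn : t n != n by rewrite -{2}tm (inj_eq perm_inj) eq_sym.
apply/permP => x; rewrite [RHS]permM removeE permM [(_ * t) n]permM tpermL.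
have [-> | xn] := eqVneq x n; first by rewrite (@tpermD _ j m) // remove_fix.
have [-> | xj] := eqVneq x j.
  by rewrite tpermR tpermL removeE (negPf mn) (negPf tn) tm eqxx.
rewrite (@tpermD _ n j) 1?eq_sym //; have [-> | xm] := eqVneq x m.
  by rewrite tpermR tm eqxx removeE (negPf jn) (negPf tj).
rewrite (@tpermD _ j m) 1?eq_sym // removeE (negPf xn).
by have -> : (t x == n) = false by rewrite -tm (inj_eq perm_inj) (negPf xm).
Qed.

Lemma remove_tperm_comm n i j t : i != n -> i != j ->
  remove i (tperm n j * t) = tperm n j * remove i t.
Proof. by move=> i_n ij; rewrite /remove permM tpermD 1?eq_sym // mulgA. Qed.

Lemma nfact_near_rec D t n : n \in D -> perm_on D t -> t n != n -> (2 < #|D|)%N ->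
  nfact_near D t = \sum_(j in D :\ n | t j != n) nfact_near (D :\ n) (remove n (tperm n j * t)).
Proof.
move=> nD tD tn D2; pose m := t^-1 n.
have tm : t m = n by rewrite permKV.
have mn : m != n by apply: contra_neq tn => {1}<-.
have mD : m \in D by rewrite -(perm_closed _ tD) tm.
have rD : perm_on (D :\ n) (remove n t) by apply: perm_on_remove.
have D2i i j : i \in D -> j \in D :\ i -> D :\ i :\ j != set0.
  move=> iD jD; rewrite -card_gt0.
  by have := cardsD1 i D; have := cardsD1 j (D :\ i); rewrite iD jD; lia.
have mDn : m \in D :\ n by rewrite !inE mn.
have tj_m j : (t j != n) = (j != m) by rewrite -{1}tm (inj_eq perm_inj).
(* The summand [i = n] on the left, expanded at [m], will match the diagonal summands [i = j] on the
   right; the summands [i != n], expanded at [n], will match the others. *)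
rewrite /nfact_near (bigD1 n) /= ?nD //.
rewrite (nfact_recl mDn (D2i _ _ nD mDn) rD).
under [RHS]eq_bigr => j jP do rewrite big_mkcondr /= (bigD1 j (proj1 (andP jP))) /=.
rewrite big_split /=; congr (_ + _)%N.
  rewrite [RHS](eq_bigl (fun j => j \in D :\ n :\ m)); last first.
    by move=> j; rewrite !inE tj_m andbC.
  rewrite [LHS]big_mkcondr /=; apply: eq_bigr => j; rewrite 2!inE => /andP[jm jD].
  have jn : j != n by move: jD; rewrite !inE => /andP[].
  rewrite (@remove_tperm n j m) ?tj_m // permM tpermL.
  by [].
rewrite [RHS](exchange_big_dep (mem (D :\ n))) /=; last by move=> j i _ /andP[].
rewrite (eq_bigl (fun i => (i \in D :\ n) && (t i != i))); last first.
  by move=> i; rewrite !inE andbC andbA.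
rewrite big_mkcondr /=; apply: eq_bigr => i iDn.
have [i_n iD] : i != n /\ i \in D by move: iDn; rewrite !inE => /andP[].
have nDi : n \in D :\ i by rewrite !inE eq_sym i_n.
rewrite -[RHS]big_mkcondr /=.
(* The two sides delete [i] and [n] from [tperm n j * t] in opposite orders; their side conditions
   agree. *)
have cond j : i != j -> (t i != i) && (remove i t j != n) =
    (t j != n) && (remove n (tperm n j * t) i != i).
  move=> ij; have := remove_nonfixC (tperm n j * t) i_n.
  by rewrite remove_tperm_comm // !permM tpermL tpermD // 1?eq_sym.
have DC : D :\ n :\ i = D :\ i :\ n by apply/setP=> x; rewrite !inE andbCA.
case: ifPn => ti; last first.
  rewrite big_pred0 // => j; apply/negP => /andP[/andP[jP jQ] jR].
  have ij : i != j by move: jQ => /andP[].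
  by have := cond j ij; rewrite (negPf ti) jR; case/andP: jP => _ ->.
rewrite (nfact_recr nDi (D2i _ _ iD nDi) (perm_on_remove iD tD)).
apply: eq_big => [j | j /andP[jD _]].
  rewrite !inE; have [-> | ij] := eqVneq j i; first by rewrite !andbF.
  have := cond j; rewrite eq_sym => /(_ ij); rewrite ti /= => ->.
  by rewrite (iDn : pred_of_set (D :\ n) i = true) /= !andbT !andbA.
have ij : i != j by rewrite eq_sym; move: jD; rewrite !inE => /and3P[].
by rewrite DC -remove_tperm_comm //; congr (nfact _ _); apply: removeC.
Qed.

Lemma nfact1 i : nfact [set i] 1 = 1%N.
Proof.
rewrite /nfact (big_pred1 1) // => b /=; rewrite mulg1 andbb.
apply/idP/eqP => [/full_cycle_perm_on bD | ->].
  by apply: perm_on_id bD _; rewrite cards1.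
by rewrite /full_cycle perm_on1 cards1 addn1 card_porbits1 eqxx.
Qed.

(* Boccara's theorem. *)
Lemma nfact_nearE D t : perm_on D t -> odd_perm t ->
  nfact_near D t = (2 * (#|D| - 2)`!)%N.
Proof.
have [k] := ubnP #|D|; elim: k D t => // k IH D t ltDk tD odt.
have /existsP[n tn] : [exists n, t n != n].
  apply: contraTT odt => /existsPn t1; suff -> : t = 1 by rewrite odd_perm1.
  by apply/permP => x; rewrite perm1; apply/eqP/negbNE/t1.
have nD : n \in D by apply: contraNT tn => /(out_perm tD) ->.
have tnD : t n \in D :\ n by rewrite !inE tn (perm_closed _ tD).
have cD := cardsD1 n D; rewrite nD in cD.
have cDn := cardsD1 (t n) (D :\ n); rewrite tnD in cDn.
(* In the base case [t] swaps the two points of [D], and each deletion leaves the identity on one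
   point, with one factorization: the total is 2. *)
have [D2 | D2] := leqP #|D| 2.
  have c0 : #|D :\ n :\ t n| = 0%N by lia.
  have DE : D = [set n; t n].
    move/eqP: c0; rewrite cards_eq0 => /eqP c0.
    by rewrite -(setD1K nD) -(setD1K tnD) c0 setU0.
  have tE : t = tperm n (t n).
    apply/eqP; rewrite -[t in t == _](removeK n) -{2}[tperm _ _]mul1g (inj_eq (mulIg _)).
    apply/eqP; apply: perm_on_id (perm_on_remove nD tD) _; lia.
  have tt : t (t n) = n by rewrite {1}tE tpermR.
  have r1 i : i \in D -> remove i t = 1.
    move=> iD; apply: perm_on_id (perm_on_remove iD tD) _.
    by have := cardsD1 i D; rewrite iD; lia.
  have -> : (#|D| - 2)`! = 1%N by have -> : (#|D| - 2 = 0)%N by lia.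
  rewrite /nfact_near (eq_bigl (mem D)) /=; last first.
    move=> i; rewrite DE !inE; case: eqP => [-> | _] /=; first by rewrite tn.
    by case: eqP => [-> | //]; rewrite tt eq_sym tn.
  rewrite (bigD1 n) //= (bigD1 (t n)) /=; last by move: tnD; rewrite !inE andbC.
  rewrite big_pred0 ?r1 ?(perm_closed _ tD) //; last first.
    by move=> i; rewrite DE !inE; do 2![case: eqP => //=].
  have -> : D :\ n = [set t n].
    by apply/setP=> x; rewrite DE !inE; case: eqP => [-> | //]; rewrite eq_sym (negPf tn).
  have -> : D :\ t n = [set n].
    by apply/setP=> x; rewrite DE !inE; case: eqP => [-> | _]; rewrite ?(negPf tn) ?orbF.
  by rewrite !nfact1.
rewrite (nfact_near_rec nD tD tn D2).
rewrite (eq_bigr (fun=> (2 * (#|D :\ n| - 2)`!)%N)); last first.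
  move=> j /andP[jD tj]; have jn : j != n by move: jD; rewrite !inE => /andP[].
  have jD' : j \in D by move: jD; rewrite !inE => /andP[].
  apply: IH; first by lia.
    by apply: perm_on_remove => //; apply: perm_onM => //; apply: perm_on_tperm.
  (* The transposition and the deletion of the moved point [n] each change the parity, so the
     permutation is odd again. *)
  by rewrite odd_remove odd_mul_tperm odt eq_sym jn permM tpermL tj.
rewrite sum_nat_const.
have -> : #|[pred j in D :\ n | t j != n]| = (#|D| - 2)%N.
  have mDn : t^-1 n \in D :\ n.
    rewrite !inE (perm_closed _ (perm_onV tD)) nD andbT.
    by apply: contra_neq tn => {1}<-; rewrite permKV.
  have := cardsD1 (t^-1 n) (D :\ n); rewrite mDn.
  suff -> : #|D :\ n :\ t^-1 n| = #|[pred j in D :\ n | t j != n]| by lia.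
  apply: eq_card => j; rewrite !inE andbC; congr (_ && _).
  by rewrite -(inj_eq (@perm_inj _ t)) permKV.
have -> : (#|D :\ n| - 2)%N = (#|D| - 2).-1 by lia.
have : (0 < #|D| - 2)%N by lia.
by case: (#|D| - 2)%N => // k' _; rewrite factS /=; lia.
Qed.

(** * Counting permutations by their number of cycles *)

Lemma sum_perm_on_remove D i (F : {perm T} -> nat) : i \in D ->
  \sum_(t | perm_on D t && (t i != i)) F (remove i t) =
  (#|D :\ i| * \sum_(t | perm_on (D :\ i) t) F t)%N.
Proof.
move=> iD; rewrite (partition_big (fun t => t i) (mem (D :\ i))) /=; last first.
  by move=> t /andP[tD ti]; rewrite !inE ti (perm_closed _ tD).
rewrite -sum_nat_const; apply: eq_bigr => j; rewrite !inE => /andP[ji jD].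
rewrite (reindex_inj (mulIg (tperm i j))) /=; apply: eq_big => [t | t].
  have tE : ((t * tperm i j) i == j) = (t i == i).
    by rewrite permM -{2}(tpermL i j) (inj_eq perm_inj).
  rewrite tE; have [ti | ti] := eqVneq (t i) i; last first.
    rewrite andbF; apply/esym/negbTE; apply: contra ti => tD.
    by rewrite (out_perm tD) // !inE eqxx.
  have -> : (t * tperm i j) i = j by apply/eqP; rewrite tE ti.
  rewrite ji !andbT; apply/idP/idP => tD; last first.
    apply: perm_onM; last exact: perm_on_tperm.
    by apply: perm_onS tD; apply: subD1set.
  apply: perm_onD1 ti; rewrite -[t]mulg1 -(tperm2 i j) mulgA.
  by apply: perm_onM => //; apply: perm_on_tperm.
by case/andP=> _ /eqP tj; rewrite /remove tj -mulgA tperm2 mulg1.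
Qed.

(** The points outside [D] are fixed, so the condition asks for [c] cycles inside [D]. The Stirling
    recurrence arises by asking whether a point [n] is moved (then it is deleted, with [#|D :\ n|]
    possible images) or fixed. *)
Lemma sum_perm_on_porbits D c :
  \sum_(t | perm_on D t && (#|porbits t| + #|D| == #|T| + c)%N) 1 = stirling1 #|D| c.
Proof.
have [k] := ubnP #|D|; elim: k D c => // k IH D c ltDk.
have [D0 | [n nD]] := set_0Vmem D.
  have on0 t : perm_on D t = (t == 1).
    apply/idP/eqP => [tD | ->]; last exact: perm_on1.
    by apply: perm_on_id tD _; rewrite D0 cards0.
  rewrite (eq_bigl (fun t => (t == 1) && (c == 0%N))); last first.
    move=> t; rewrite on0; case: eqP => // -> /=.
    by rewrite card_porbits1 D0 cards0 addn0 -{1}[#|T|]addn0 eqn_add2l eq_sym.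
  by rewrite D0 cards0; case: c => [|c] /=; [rewrite (big_pred1 1) | rewrite big_pred0] => // t; rewrite ?andbT ?andbF.
have cD := cardsD1 n D; rewrite nD add1n in cD.
have D0 : D != set0 by apply/set0Pn; exists n.
case: c => [|c].
  rewrite cD big_pred0 // => t; apply/negP => /andP[tD].
  by have := card_porbits_gt tD D0; lia.
rewrite (bigID (fun t => t n != n)) /= cD /=; congr (_ + _)%N.
  rewrite -(IH _ c.+1); last by lia.
  rewrite [in RHS]big_mkcondr /=.
  rewrite -(sum_perm_on_remove (fun t => if (#|porbits t| + #|D :\ n| == #|T| + c.+1)%N then 1%N else 0%N)) //.
  rewrite [RHS]big_mkcond [LHS]big_mkcond /=.
  apply: eq_bigr => t _; rewrite card_porbits_remove.
  case: (perm_on D t) => //=; case: (t n != n) => //=; rewrite ?andbF //.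
  by rewrite andbT addnAC addn1 -addnS.
rewrite -(IH _ c); last by lia.
apply: eq_bigl => t; rewrite negbK.
have -> : perm_on (D :\ n) t = perm_on D t && (t n == n).
  apply/idP/andP => [tD | [tD /eqP]]; last exact: perm_onD1.
  split; first by apply: perm_onS tD; apply: subD1set.
  by rewrite (out_perm tD) // !inE eqxx.
rewrite !addnS eqSS; by case: (perm_on D t); rewrite //= andbC.
Qed.

Lemma full_cycle_gt0 D b : full_cycle D b -> (0 < #|D|)%N.
Proof.
case/andP=> bD cb; rewrite lt0n cards_eq0; apply: contraTN cb => /eqP D0.
have -> : b = 1 by apply: perm_on_id bD _; rewrite D0 cards0.
by rewrite card_porbits1 D0 cards0; lia.
Qed.

Lemma sum_full_cycles D : D != set0 -> \sum_(b | full_cycle D b) 1 = (#|D|.-1)`!.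
Proof.
rewrite -card_gt0 => D0; rewrite -stirling1_1 prednK // -sum_perm_on_porbits.
by apply: eq_bigl => b; rewrite addn1.
Qed.

(** Otherwise [tperm x y] would merge two orbits, leaving fewer than [card_porbits_gt] allows. *)
Lemma full_cycle_porbit D b x y : full_cycle D b -> x \in D -> y \in D -> y \in porbit b x.
Proof.
case/andP=> bD /eqP cb xD yD; rewrite porbit_sym; apply/negPn/negP => xy.
have : (#|porbits (tperm x y * b)| + 2 = #|porbits b| + (x != y))%N.
  by rewrite -porbits_mul_tperm xy.
have : perm_on D (tperm x y * b) by apply: perm_onM => //; apply: perm_on_tperm.
have D0 : D != set0 by apply/set0Pn; exists x.
move=> /card_porbits_gt/(_ D0); move: cb; case: (x != y) => /=; lia.
Qed.

(** * Conjugacy of full cycles and the count of pairs *)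

Lemma porbitJ s u x : porbit (s ^ u) (u x) = u @: porbit s x.
Proof.
apply/setP => y; apply/porbitP/imsetP => [[k ->] | [z /porbitP[k ->] ->]].
  by exists ((s ^+ k) x); rewrite ?mem_porbit // -conjXg permJ.
by exists k; rewrite -conjXg permJ.
Qed.

Lemma card_porbitsJ s u : #|porbits (s ^ u)| = #|porbits s|.
Proof.
have -> : porbits (s ^ u) = (fun X : {set T} => u @: X) @: porbits s.
  apply/setP => X; apply/imsetP/imsetP => [[x _ ->] | [_ /imsetP[x _ ->] ->]].
    by exists (porbit s (u^-1 x)); rewrite ?imset_f // -porbitJ permKV.
  by exists (u x); rewrite ?porbitJ.
by rewrite card_imset //; apply: imset_inj; apply: perm_inj.
Qed.

Lemma perm_onJ D s u : perm_on (u @: D) (s ^ u) = perm_on D s.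
Proof.
apply/subsetP/subsetP => sD x; rewrite !inE => sx.
  by rewrite -(mem_imset _ _ (@perm_inj _ u)) sD // inE permJ (inj_eq perm_inj).
rewrite -[x](permKV u) mem_imset; last exact: perm_inj.
by apply: sD; rewrite inE -(inj_eq (@perm_inj _ u)) -permJ permKV.
Qed.

Lemma full_cycleJ D b u : full_cycle (u @: D) (b ^ u) = full_cycle D b.
Proof. by rewrite /full_cycle perm_onJ card_porbitsJ card_imset //; apply: perm_inj. Qed.

Lemma conjg_disjoint D s u : perm_on D s -> perm_on (~: D) u -> s ^ u = s.
Proof.
move=> sD uD; apply/conjg_fixP/commgP; apply: (perm_onC sD uD).
by rewrite -setI_eq0 setICr.
Qed.

Lemma full_cycle_conj D E a b : full_cycle D a -> full_cycle E b -> #|D| = #|E| ->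
  exists2 u : {perm T}, u @: D = E & a ^ u = b.
Proof.
have [k] := ubnP #|D|; elim: k D E a b => // k IH D E a b ltDk aD bE cDE.
have /card_gt0P[x xD] := full_cycle_gt0 aD.
have /card_gt0P[y yE] := full_cycle_gt0 bE.
have cD := cardsD1 x D; have cE := cardsD1 y E; rewrite xD in cD; rewrite yE in cE.
have [aon bon] := (full_cycle_perm_on aD, full_cycle_perm_on bE).
have [D0 | D0] := eqVneq (D :\ x) set0.
  have D1 : D = [set x] by rewrite -(setD1K xD) D0 setU0.
  have E1 : E = [set y].
    rewrite -(setD1K yE); suff /eqP-> : E :\ y == set0 by rewrite setU0.
    by rewrite -cards_eq0; rewrite D0 cards0 in cD; lia.
  exists (tperm x y); first by rewrite D1 E1 imset_set1 tpermL.
  have -> : a = 1 by apply: perm_on_id aon _; rewrite D1 cards1.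
  have -> : b = 1 by apply: perm_on_id bon _; rewrite E1 cards1.
  by rewrite conj1g.
have E0 : E :\ y != set0 by rewrite -card_gt0; rewrite -card_gt0 in D0; lia.
have aD' := full_cycle_remove xD D0 aD; have bE' := full_cycle_remove yE E0 bE.
have [||u uD ua] := IH _ _ _ _ _ aD' bE'; [lia | lia |].
have axD := full_cycle_im aD xD D0; have byE := full_cycle_im bE yE E0.
have uaxE : u (a x) \in E :\ y by rewrite -uD imset_f.
have /porbitP[e be] := full_cycle_porbit bE' uaxE byE.
(* A power of [remove y b] commutes with it, so the conjugation survives; [e] is chosen so that [v]
   sends [a x] to [b y]. *)
pose v := u * remove y b ^+ e.
have bon' := full_cycle_perm_on bE'.
have eE : perm_on (E :\ y) (remove y b ^+ e).
  by elim: e {be v} => [|e IHe]; rewrite ?expg0 ?perm_on1 // expgS perm_onM.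
have vD : v @: (D :\ x) = E :\ y.
  rewrite -[RHS](im_perm_on eE) -uD -imset_comp; apply: eq_imset => z.
  by rewrite permM.
have va : remove x a ^ v = remove y b.
  rewrite conjgM ua; apply/conjg_fixP/commgP; apply: commuteX; apply: commute_refl.
have vx : v x \in ~: (E :\ y).
  by rewrite inE -vD mem_imset ?inE ?eqxx //; apply: perm_inj.
have yE' : y \in ~: (E :\ y) by rewrite !inE eqxx.
(* Both [v x] and [y] lie outside [E :\ y], so [w] repairs the image of [x] without disturbing the
   smaller cycle. *)
pose w := tperm (v x) y.
have wE : perm_on (~: (E :\ y)) w by apply: perm_on_tperm.
have wid z : z \in E :\ y -> w z = z.
  by move=> zE; rewrite (out_perm wE) // inE zE.
have uax : (v * w) (a x) = b y.
  by rewrite !permM -be wid.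
have ux : (v * w) x = y by rewrite permM tpermL.
have uD' : (v * w) @: (D :\ x) = E :\ y.
  rewrite -vD; apply/setP => z; apply/imsetP/imsetP => -[z' z'D ->]; exists z' => //.
    by rewrite permM wid // -vD imset_f.
  by rewrite permM wid // -vD imset_f.
exists (v * w).
  by rewrite -(setD1K xD) imsetU1 uD' ux setD1K.
rewrite -[a](removeK x) conjMg tpermJ ux uax conjgM va.
by rewrite (conjg_disjoint bon' wE) removeK.
Qed.

(* With [b] a full cycle on [E], this counts the full cycles [a] on [E] such
   that [b^-1 * a], seen as a permutation of [E], has [c] cycles. *)
Definition ncycle_pairs E b c :=
  \sum_(a | full_cycle E a && (#|porbits (b^-1 * a)| + #|E| == #|T| + c)%N) 1.

Lemma ncycle_pairs_conj D E a b c : full_cycle D a -> full_cycle E b -> #|D| = #|E| ->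
  ncycle_pairs D a c = ncycle_pairs E b c.
Proof.
move=> aD bE cDE; have [u <- <-] := full_cycle_conj aD bE cDE.
rewrite /ncycle_pairs [RHS](reindex_inj (conjg_inj u)) /=; apply: eq_bigl => s.
by rewrite full_cycleJ -conjVg -conjMg card_porbitsJ card_imset //; apply: perm_inj.
Qed.

Lemma sum_nfact E b c : full_cycle E b ->
  \sum_(t | perm_on E t && (#|porbits t| + #|E| == #|T| + c)%N) nfact E t =
  ((#|E|.-1)`! * ncycle_pairs E b c)%N.
Proof.
move=> bE; have E0 : E != set0 by rewrite -card_gt0 (full_cycle_gt0 bE).
rewrite /nfact (exchange_big_dep (full_cycle E)) /=; last by move=> t a _ /andP[].
rewrite -sum_full_cycles // big_distrl /=; apply: eq_bigr => a aE; rewrite mul1n.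
rewrite (ncycle_pairs_conj c bE aE erefl) /ncycle_pairs.
rewrite (reindex_inj (mulgI a^-1)) /=; apply: eq_bigl => t.
rewrite aE mulKVg /=; have aon := full_cycle_perm_on aE.
case tE: (full_cycle E t); rewrite ?andbF // andbT /= perm_onM ?perm_onV //.
exact: full_cycle_perm_on tE.
Qed.

Lemma ncycle_pairsE E b c z : full_cycle E b -> z \notin E -> ~~ odd (#|E| + c) ->
  (#|E|.+1 * #|E| * ncycle_pairs E b c = 2 * stirling1 #|E|.+1 c)%N.
Proof.
move=> bE zE pc; have E0 := full_cycle_gt0 bE.
pose D := z |: E; have cD : #|D| = #|E|.+1 by rewrite cardsU1 zE.
have fact_gt := fact_gt0 #|E|.-1.
apply/eqP; rewrite -(eqn_pmul2l fact_gt); apply/eqP.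
(* Double counting: by the deleted point [i], each deletion being [#|E|] to one, and by Boccara's
   theorem, which applies as the parity hypothesis makes every [t] odd. *)
transitivity (\sum_(t | perm_on D t && (#|porbits t| + #|D| == #|T| + c)%N) nfact_near D t).
  rewrite /nfact_near (exchange_big_dep (mem D)) /=; last by move=> t i _ /andP[].
  rewrite (eq_bigr (fun=> #|E| * ((#|E|.-1)`! * ncycle_pairs E b c))%N).
    by rewrite sum_nat_const cD; lia.
  move=> i iD; have cDi : #|D :\ i| = #|E| by have := cardsD1 i D; rewrite iD; lia.
  have [a aD] : exists a, full_cycle (D :\ i) a.
    have : (0 < \sum_(b | full_cycle (D :\ i) b) 1)%N.
      by rewrite sum_full_cycles ?fact_gt0 // -card_gt0 cDi.
    by rewrite sum1dep_card => /card_gt0P[a]; rewrite inE; exists a.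
  rewrite (ncycle_pairs_conj c bE aD) // -cDi -sum_nfact // [in RHS]big_mkcondr.
  rewrite -(sum_perm_on_remove (fun t => if (#|porbits t| + #|D :\ i| == #|T| + c)%N
     then nfact (D :\ i) t else 0%N)) //.
  rewrite [RHS]big_mkcond [LHS]big_mkcond /=; apply: eq_bigr => t _.
  rewrite iD card_porbits_remove cDi cD.
  case: (perm_on D t) => //=; case: (t i != i) => //=; rewrite ?andbF //.
  by rewrite andbT addnAC addn1 -addnS.
rewrite (eq_bigr (fun=> (2 * (#|D| - 2)`!)%N)); last first.
  move=> t /andP[tD /eqP ct]; apply: nfact_nearE => //.
  by rewrite /odd_perm; move: pc ct; rewrite cD; lia.
have -> : (#|D| - 2 = #|E|.-1)%N by lia.
rewrite sum_nat_const -cD -sum_perm_on_porbits -sum1_card mulnCA mulnA mulnC.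
by congr (_ * (_ * _))%N; apply: eq_bigl.
Qed.

End CycleSurgery.

(** * Adding a spare point *)

Section OptionTransport.
Variable T : finType.
Implicit Types (s t u a b : {perm T}) (D E : {set T}) (i j n x y : T).

(** The fixed point [None] supplies the point outside [E] that [ncycle_pairsE] asks for, even when
    [E] is all of [T]. *)
Definition operm s : {perm option T} := perm (inj_omap (@perm_inj _ s)).

Lemma opermE s x : operm s (Some x) = Some (s x).
Proof. by rewrite permE. Qed.

Lemma operm_None s : operm s None = None.
Proof. by rewrite permE. Qed.

Lemma operm_inj : injective operm.
Proof.
move=> s t st; apply/permP => x; apply: Some_inj.
by rewrite -!opermE st.
Qed.

Lemma opermM s t : operm (s * t) = operm s * operm t.
Proof. by apply/permP => -[x|]; rewrite permM ?operm_None // !opermE permM. Qed.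

Lemma opermV s : operm s^-1 = (operm s)^-1.
Proof.
apply: (mulIg (operm s)); rewrite mulVg -opermM mulVg.
by apply/permP => -[x|]; rewrite ?operm_None ?opermE !perm1.
Qed.

Lemma opermX s k x : (operm s ^+ k) (Some x) = Some ((s ^+ k) x).
Proof.
by elim: k => [|k IH]; rewrite ?perm1 // !expgSr !permM IH opermE.
Qed.

Lemma card_porbits_operm s : #|porbits (operm s)| = #|porbits s|.+1.
Proof.
pose F (X : {set T}) : {set option T} := Some @: X.
have porb x : porbit (operm s) (Some x) = F (porbit s x).
  apply/setP=> y; apply/porbitP/imsetP => [[k ->] | [z /porbitP[k ->] ->]].
    by exists ((s ^+ k) x); rewrite ?mem_porbit ?opermX.
  by exists k; rewrite opermX.
have -> : porbits (operm s) = porbit (operm s) None |: F @: porbits s.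
  apply/setP => X; rewrite !inE; apply/imsetP/orP => [[[x|] _ ->] | [/eqP-> | /imsetP[_ /imsetP[x _ ->] ->]]].
  - by right; rewrite porb !imset_f.
  - by left.
  - by exists None.
  - by exists (Some x).
rewrite cardsU1 card_imset; last by apply: imset_inj; apply: Some_inj.
suff -> : porbit (operm s) None \notin F @: porbits s by [].
apply/imsetP => -[X _ /setP/(_ None)]; rewrite porbit_id => /esym/imsetP[x _].
by [].
Qed.

Lemma perm_on_operm E s : perm_on (Some @: E) (operm s) = perm_on E s.
Proof.
apply/subsetP/subsetP => sE; last first.
  move=> [x|]; rewrite !inE ?operm_None ?eqxx // opermE mem_imset; last exact: Some_inj.
  by move=> sx; apply: sE; rewrite inE; apply: contra_neq sx => ->.
move=> x; rewrite !inE => sx; rewrite -(mem_imset _ _ Some_inj).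
by apply: sE; rewrite inE opermE; apply: contra_neq sx => -[].
Qed.

Lemma operm_im E : operm @: [set s | perm_on E s] = [set t | perm_on (Some @: E) t].
Proof.
apply/eqP; rewrite eqEcard card_imset; last exact: operm_inj.
rewrite !cardsE !card_perm card_imset ?leqnn ?andbT; last exact: Some_inj.
by apply/subsetP => _ /imsetP[s sE ->]; move: sE; rewrite !inE perm_on_operm.
Qed.

Lemma full_cycle_operm E s : full_cycle (Some @: E) (operm s) = full_cycle E s.
Proof.
rewrite /full_cycle perm_on_operm card_porbits_operm card_imset; last exact: Some_inj.
by rewrite card_option addSn eqSS.
Qed.

Lemma ncycle_pairs_operm E b c :
  ncycle_pairs (Some @: E) (operm b) c = ncycle_pairs E b c.
Proof.
rewrite /ncycle_pairs.
rewrite (eq_bigl (fun t : {perm option T} => (t \in operm @: [set s | perm_on E s]) &&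
   (full_cycle (Some @: E) t && (#|porbits ((operm b)^-1 * t)| + #|E| == #|T|.+1 + c)%N))).
  rewrite big_imset_cond /=; last by move=> s t _ _; apply: operm_inj.
  apply: eq_bigl => s; rewrite inE full_cycle_operm -opermV -opermM card_porbits_operm.
  by rewrite !addSn eqSS andbA; congr (_ && _); rewrite andb_idl // => /full_cycle_perm_on.
move=> a; rewrite operm_im inE card_option card_imset; last exact: Some_inj.
by rewrite andbA; congr (_ && _); rewrite andb_idl // => /full_cycle_perm_on.
Qed.

(* The Zagier-Stanley formula. *)
Lemma ncycle_pairs_stirling E b c : full_cycle E b -> ~~ odd (#|E| + c) ->
  (#|E|.+1 * #|E| * ncycle_pairs E b c = 2 * stirling1 #|E|.+1 c)%N.
Proof.
move=> bE pc; have cE : #|[set Some x | x in E]| = #|E| by apply: card_imset; apply: Some_inj.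
rewrite -ncycle_pairs_operm -cE (@ncycle_pairsE _ _ _ _ None) ?cE ?full_cycle_operm //.
by apply/imsetP => -[].
Qed.

End OptionTransport.

(** * Restricting a cycle to a subset; cycles and their supports *)

Section Deletion.
Variable T : finType.
Implicit Types (s t u a b w : {perm T}) (D E S : {set T}) (i j n x y : T).

(** The points outside [S] are deleted from [w] one at a time. Since [s] fixes the deleted [i],
    going back to [w] merges [i] into another orbit, and this loss balances the extra point of
    [D]. *)
Lemma full_cycle_restrict D S w : full_cycle D w -> S \subset D -> S != set0 ->
  exists2 w', full_cycle S w' & forall s, perm_on S s ->
    (#|porbits (w^-1 * s)| + #|D| = #|porbits (w'^-1 * s)| + #|S|)%N.
Proof.
have [k] := ubnP #|D|; elim: k D w => // k IH D w ltDk wD sSD S0.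
have [sDS | /subsetPn[i iD iS]] := boolP (D \subset S).
  have -> : S = D by apply/eqP; rewrite eqEsubset sSD.
  by exists w.
have cD := cardsD1 i D; rewrite iD add1n in cD.
have sSDi : S \subset D :\ i by rewrite subsetD1 sSD.
have Di0 : D :\ i != set0 by apply: contraNneq S0 => Di0; rewrite -subset0 -Di0.
have [|w' w'S w'E] := IH _ _ _ (full_cycle_remove iD Di0 wD) sSDi S0; first by lia.
exists w' => // s sS; have := w'E s sS.
have := card_porbits_mulr_tperm (s := (remove i w)^-1 * s) (i := i) (j := w i).
rewrite permM (canLR (permK _) (esym (remove_fix i w))) (out_perm sS) //.
move=> /(_ erefl); rewrite eq_sym (full_cycle_nonfix wD) // => /(_ isT).
(* Conjugation carries the transposition from the right end to the left, where it turns
   [(remove i w)^-1] into [w^-1]. *)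
rewrite -(card_porbitsJ _ (tperm i (w i))) conjgE tpermV.
have -> : tperm i (w i) * ((remove i w)^-1 * s * tperm i (w i) * tperm i (w i)) = w^-1 * s.
  by rewrite -[_ * tperm _ _ * tperm _ _]mulgA tperm2 mulg1 {1}/remove invMg tpermV !mulgA tperm2 mul1g.
by lia.
Qed.

Lemma full_cycle_support D s : full_cycle D s -> (1 < #|D|)%N -> D = [set x | s x != x].
Proof.
move=> sD D1; apply/setP => x; rewrite inE; apply/idP/idP => [xD | ].
  apply: (full_cycle_nonfix sD xD).
  by rewrite -card_gt0; have := cardsD1 x D; rewrite xD; lia.
by apply: contraNT => xD; rewrite (out_perm (full_cycle_perm_on sD)).
Qed.

(** A cycle of length at least 2 determines its support, whereas the identity is a full cycle on
    every singleton. *)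
Lemma card_full_cycle_sets D s : full_cycle D s ->
  #|[set E : {set T} | (#|E| == #|D|) && full_cycle E s]| = if #|D| == 1%N then #|T| else 1%N.
Proof.
move=> sD; have D0 := full_cycle_gt0 sD; case: eqP => D1; last first.
  apply/eqP/cards1P; exists D; apply/setP => E; rewrite !inE.
  apply/andP/eqP => [[/eqP cE sE] | ->]; last by [].
  have D2 : (1 < #|D|)%N by lia.
  have E2 : (1 < #|E|)%N by rewrite cE.
  exact: etrans (full_cycle_support sE E2) (esym (full_cycle_support sD D2)).
have -> : s = 1 by apply: perm_on_id (full_cycle_perm_on sD) _; rewrite D1.
rewrite D1 -[RHS]bin1 -card_draws; apply: eq_card => E; rewrite !inE.
case: eqP => //= cE; by rewrite /full_cycle perm_on1 card_porbits1 cE addn1 eqxx.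
Qed.

Lemma full_cycle_porbits D s : full_cycle D s ->
  porbits s = D |: (fun x => [set x]) @: (~: D).
Proof.
move=> sD; have son := full_cycle_perm_on sD.
have inD x : x \in D -> porbit s x = D.
  move=> xD; apply/setP => y; apply/idP/idP => [/porbitP[k ->] | yD].
    by elim: k => [|k]; rewrite ?perm1 // expgSr permM (perm_closed _ son).
  exact: full_cycle_porbit sD xD yD.
have outD x : x \notin D -> porbit s x = [set x].
  move=> xD; apply/setP => y; rewrite inE; apply/porbitP/eqP => [[k ->] | ->].
    elim: k => [|k IH]; first by rewrite perm1.
    by rewrite expgSr permM IH (out_perm son).
  by exists 0%N; rewrite perm1.
have /card_gt0P[z zD] := full_cycle_gt0 sD.
apply/setP => X; rewrite !inE.
apply/imsetP/orP => [[x _ ->] | [/eqP-> | /imsetP[x xD ->]]].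
- case xD: (x \in D); [left | right]; first by rewrite inD.
  by rewrite outD ?xD // imset_f // inE xD.
- by exists z; rewrite ?inD.
- by exists x => //; rewrite outD //; move: xD; rewrite inE.
Qed.

End Deletion.

Lemma full_cycle_omega n : (0 < n)%N -> full_cycle [set: 'I_n] (omega n).
Proof.
case: n => // n _; apply/andP; split; first by apply/subsetP => x; rewrite inE.
suff -> : porbits (omega n.+1) = [set [set: 'I_n.+1]].
  by rewrite cards1 cardsT card_ord.
have orb0 : porbit (omega n.+1) ord0 = [set: 'I_n.+1].
  apply/setP => y; rewrite inE; apply/porbitP; exists y; apply: val_inj.
  rewrite permX; suff H k : (k <= n)%N -> val (iter k (omega n.+1) ord0) = k.
    by rewrite H // -ltnS.
  elim: k => // k IH kn; rewrite iterS permE /= IH 1?ltnW // modn_small //.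
apply/setP => X; rewrite inE; apply/imsetP/eqP => [[x _ ->] | ->]; last by exists ord0.
by apply/eqP; rewrite -orb0 eq_porbit_mem orb0 inE.
Qed.

(** * Permutations of hook cycle type *)

Section HookPartition.
Variables n p : nat.
Hypothesis ltpn : (p < n)%N.
Let hook := hook_partition n p.

Lemma full_cycle_hook (D : {set 'I_n}) s : full_cycle D s -> #|D| = (n - p)%N ->
  has_cycle_type s hook.
Proof.
move=> sD cD; rewrite /has_cycle_type /hook /hook_partition.
have perm_orb : perm_eq (enum (porbits s)) (D :: [seq [set x] | x <- enum (~: D)]).
  apply: uniq_perm; rewrite ?enum_uniq //=.
    rewrite map_inj_uniq ?enum_uniq ?andbT; last exact: set1_inj.
    by apply/mapP => -[x]; rewrite mem_enum inE => xD DE; rewrite DE inE eqxx in xD.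
  move=> X; rewrite mem_enum (full_cycle_porbits sD) !inE; congr (_ || _).
  by apply/imsetP/mapP => -[x xD ->]; exists x; rewrite ?mem_enum // -mem_enum.
rewrite (perm_trans (perm_map _ perm_orb)) //= perm_sym perm_rcons cD perm_cons.
rewrite -map_comp; have cDC : #|~: D| = p by have := cardsC D; rewrite card_ord cD; lia.
rewrite -cDC cardE -(size_map ((fun X : {set 'I_n} => #|X|) \o set1)).
by rewrite -(all_pred1P _ _ _) // all_map; apply/allP => x _ /=; rewrite cards1.
Qed.

(** An orbit of size [n - p] is split off; all remaining orbits have size 1, so the points outside
    it are fixed. *)
Lemma hook_full_cycle s : has_cycle_type s hook ->
  exists2 D : {set 'I_n}, #|D| = (n - p)%N & full_cycle D s.
Proof.
rewrite /has_cycle_type /hook /hook_partition => sh.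
have := perm_mem sh (n - p)%N; rewrite mem_rcons inE eqxx => /mapP[X].
rewrite mem_enum => Xs cX; exists X => //.
have Xs' : X \in enum (porbits s) by rewrite mem_enum.
have := perm_size sh; rewrite size_map size_rcons size_nseq -cardE => cs.
have rest : perm_eq [seq #|(Y : {set 'I_n})| | Y <- rem X (enum (porbits s))] (nseq p 1%N).
  have := perm_map (fun Y : {set 'I_n} => #|Y|) (perm_to_rem Xs').
  rewrite perm_sym => /perm_trans/(_ sh); rewrite perm_sym perm_rcons perm_sym /= -cX.
  by rewrite perm_cons.
apply/andP; split; last by rewrite cs -cX card_ord; apply/eqP; lia.
apply/subsetP => x; rewrite inE; apply: contraR => xX.
have oX : porbit s x != X by apply: contraNneq xX => <-; apply: porbit_id.
have : #|porbit s x| \in nseq p 1%N.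
  rewrite -(perm_mem rest); apply/mapP; exists (porbit s x) => //.
  by rewrite (rem_filter _ (enum_uniq _)) mem_filter /= oX mem_enum imset_f.
rewrite mem_nseq => /andP[_ /eqP/eqP/cards1P[y xy]].
have := porbit_id s x; have := mem_porbit s 1 x.
by rewrite expg1 xy !inE => /eqP-> /eqP->.
Qed.

(** Pairs of a set and a full cycle on it are counted in two ways; for [n - p = 1] the identity
    occurs once for each of the [n] singletons. *)
Lemma sum_hook (P : pred 'S_n) :
  ((if n - p == 1 then n else 1) * \sum_(s | has_cycle_type s hook && P s) 1 =
   \sum_(D : {set 'I_n} | #|D| == n - p) \sum_(s | full_cycle D s && P s) 1)%N.
Proof.
rewrite (exchange_big_dep (fun s => has_cycle_type s hook && P s)) /=; last first.
  by move=> D s /eqP cD /andP[sD ->]; rewrite (full_cycle_hook sD).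
rewrite big_distrr /=; apply: eq_bigr => s /andP[/hook_full_cycle[D cD sD] Ps].
rewrite muln1 sum1dep_card Ps -cD; have := card_full_cycle_sets sD; rewrite card_ord => <-.
by apply: eq_card => E; rewrite !inE andbT.
Qed.

Lemma class_size_sum : class_size n hook = (\sum_(s : 'S_n | has_cycle_type s hook) 1)%N.
Proof. by rewrite sum1dep_card. Qed.

(** The second factor must be [omega n * s^-1], and its inverse is conjugate to [(omega n)^-1 * s],
    the form used in [ncycle_pairs]. *)
Lemma mu_sum m : mu n m hook =
  (\sum_(s | has_cycle_type s hook && (#|porbits ((omega n)^-1 * s)| == m)) 1)%N.
Proof.
rewrite sum1dep_card; pose F (s : 'S_n) := (s, omega n * s^-1).
rewrite -(card_imset _ (f := F)); last by move=> s t [].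
have porb s : #|porbits (omega n * s^-1)| = #|porbits ((omega n)^-1 * s)|.
  by rewrite -porbitsV invMg invgK -(card_porbitsJ _ s) conjgE -mulgA mulKg.
apply: eq_card => -[s t]; rewrite inE /=; apply/and3P/imsetP.
  case=> /forallP st hs /eqP ct.
  have -> : t = omega n * s^-1.
    apply: (mulIg s); rewrite mulgKV; apply/permP => x.
    by rewrite permM; apply/eqP.
  exists s => //; rewrite inE hs -porb -ct; apply/eqP; congr #|porbits _|.
  apply: (mulIg s); rewrite mulgKV; apply/permP => x.
  by rewrite permM; apply/esym/eqP.
case=> u; rewrite inE => /andP[hu cu] [-> ->]; split => //.
  by apply/forallP => x; rewrite -permM mulgKV.
by rewrite /ncycles porb.
Qed.

Lemma mu_hook m : ~~ odd (n - p + m) ->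
  ((n - p).+1`! * mu n m hook = 2 * stirling1 (n - p).+1 m * class_size n hook)%N.
Proof.
move=> pm; set k := (n - p)%N; have k0 : (0 < k)%N by rewrite subn_gt0.
(* This multiplicity from [sum_hook] affects [mu] and the class size alike and cancels at the
   end. *)
pose q := if k == 1%N then n else 1%N.
have q0 : (0 < q)%N by rewrite /q; case: ifP => // _; apply: leq_ltn_trans ltpn.
have classE : (q * class_size n hook = \sum_(D : {set 'I_n} | #|D| == k) k.-1`!)%N.
  rewrite class_size_sum; have := sum_hook xpredT; rewrite -/q.
  under eq_bigl do rewrite andbT; move=> ->; apply: eq_bigr => D /eqP cD.
  under eq_bigl do rewrite andbT.
  by rewrite sum_full_cycles ?cD // -card_gt0 cD.
have muE : (k.+1 * k * (q * mu n m hook) = \sum_(D : {set 'I_n} | #|D| == k) 2 * stirling1 k.+1 m)%N.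
  rewrite mu_sum sum_hook big_distrr /=; apply: eq_bigr => D; rewrite -/k => /eqP cD.
  have D0 : D != set0 by rewrite -card_gt0 cD.
  have n0 : (0 < n)%N by apply: leq_ltn_trans ltpn.
  have [w wD wE] := full_cycle_restrict (full_cycle_omega n0) (subsetT D) D0.
  rewrite -cD -(ncycle_pairs_stirling wD) ?cD //; congr (_ * _)%N.
  apply: eq_bigl => s; case sD: (full_cycle D s) => //=.
  have := wE s (full_cycle_perm_on sD); rewrite cardsT card_ord => <-.
  by rewrite addnC eqn_add2l.
apply/eqP; rewrite -(eqn_pmul2l q0); apply/eqP.
(* The factor [k.-1]![counts the full cycles on each]k[-set and completes]k.+1 * k[to]k.+1[!]. *)
transitivity (k.-1`! * (k.+1 * k * (q * mu n m hook)))%N.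
  rewrite factS -{2}(prednK k0) factS prednK //; lia.
rewrite muE; transitivity (2 * stirling1 k.+1 m * (q * class_size n hook))%N; last by lia.
by rewrite classE !sum_nat_const; lia.
Qed.

(** This is a comparison of signs: [omega n] has one orbit, [s] has [p + 1], and their quotient
    would have [m]. *)
Lemma mu_hook_odd m : odd (n - p + m) -> mu n m hook = 0%N.
Proof.
move=> pm; rewrite mu_sum big_pred0 // => s; apply/negP => /andP[/hook_full_cycle[D cD]].
have n0 : (0 < n)%N by apply: leq_ltn_trans ltpn.
have := full_cycle_omega n0; rewrite /full_cycle cardsT card_ord cD.
case/andP=> _ /eqP co /andP[_ /eqP cs] /eqP cm.
have := odd_permM (omega n)^-1 s; rewrite odd_permV /odd_perm cm card_ord.
move: co cs pm ltpn => /=; lia.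
Qed.

End HookPartition.

(* Passage to rational numbers *)
Local Close Scope group_scope.
Local Open Scope ring_scope.
Import GRing.Theory Num.Theory.

Theorem theorem4p6 (n p m : nat) :
  (p < n)%N -> (0 < m)%N ->
  (~~ odd `|(n%:Z - p%:Z - m%:Z)%R|%N ->
     (mu n m (hook_partition n p))%:R
       = 2 * (stirling1 (n + 1 - p) m)%:R / ((n + 1 - p)`!)%:R
           * (class_size n (hook_partition n p))%:R :> rat) /\
  (odd `|(n%:Z - p%:Z - m%:Z)%R|%N -> mu n m (hook_partition n p) = 0%N).
Proof.
move=> ltpn _.
(* The sign of [m] does not affect parity, and [n - p] is not truncated since [p < n]. *)
have -> : odd `|(n%:Z - p%:Z - m%:Z)%R|%N = odd (n - p + m) by lia.
have -> : (n + 1 - p = (n - p).+1)%N by lia.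
split; last exact: mu_hook_odd.
move=> /(mu_hook ltpn) muE.
have f0 : ((n - p).+1`!)%:R != 0 :> rat by rewrite pnatr_eq0 -lt0n fact_gt0.
apply: (mulfI f0); rewrite mulrA [_%:R * (_ / _)]mulrC divfK //.
by rewrite -!natrM muE.
Qed.
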